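(* Let $C=\sum_{n\ge1}c_n$ be the sum of all left combs and $D=\sum_{n\ge1}d_n$ the sum of all right combs, viewed in the group $G^{\mathrm{dif}}$ of tree-expanded formal diffeomorphisms, let $D^{-1}$ be the inverse of $D$ in this group, and let $E=C\circ D^{-1}$. Then $$E=\sum_{n\ge1}\ \sum_{t\in Y_n}\mu(c_n,t)\, t$$ and $$D^{-1}=Y+\sum_{n\ge1}\ \sum_{t\in Y_n}\mu(c_{n+1},\,Y\backslash t)\; Y\backslash t,$$ where $\mu$ is the Möbius function of the Tamari lattice (on $Y_n$ in the first formula, on $Y_{n+1}$ in the second).
   Context: Trees: a planar binary rooted tree has a number of internal vertices called its order; $Y_n$ is the set of planar binary rooted trees with $n$ internal vertices. The tree with no internal vertex is denoted $|$ (root tree), and the tree with one internal vertex is denoted $Y$ (vertex tree). For trees $s,t$, $s\vee t$ is the tree obtained by grafting $s$ (left) and $t$ (right) on a new root vertex; every tree $t\neq |$ is uniquely of the form $t=t_l\vee t_r$. Over and under products: for trees $s,t\neq |$, $s/t$ (''$s$ over $t$'') is the tree obtained by grafting the root of $s$ on the left-most leaf of $t$, and $s\backslash t$ (''$s$ under $t$'') is the tree obtained by grafting the root of $t$ on the right-most leaf of $s$. Both are associative and satisfy $(a/b)\backslash c=a/(b\backslash c)$ for trees $a,b,c\neq |$. Both are extended bilinearly to formal series of trees of order at least $1$. Combs: the left comb $c_n$ and right comb $d_n$ with $n$ vertices are $c_1=d_1=Y$, $c_{n+1}=c_n/Y$, $d_{n+1}=Y\backslash d_n$. Tree-expanded series: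 for a commutative unital associative algebra $R$ (here one may take $R=\mathbb{Q}$), $G^{\mathrm{dif}}$ is the set of formal series $S=\sum_{n\ge1}\sum_{t\in Y_n} S_t\, t$ with $S_t\in R$ and $S_Y=1$. Composition is $S\circ T=\sum_{n\geq 1}\sum_{t\in Y_n} S_t\, T^t$, where $T^t$ is obtained by inserting $T$ at every internal vertex of $t$, i.e. recursively $T^{Y}=T$ and, for $t=t_l\vee t_r$, $T^t=T^{t_l}/T\backslash T^{t_r}$, where the factor $T^{t_l}/$ (respectively $\backslash T^{t_r}$) is omitted if $t_l=|$ (respectively $t_r=|$). With this operation $G^{\mathrm{dif}}$ is a group with unit the series $Y$. Tamari lattice: the partial order on $Y_n$ that is the reflexive transitive closure of the relation $t\le t'$ whenever $t'$ is obtained from $t$ by replacing, at some vertex, a subtree of the form $(t_1\vee t_2)\vee t_3$ by $t_1\vee(t_2\vee t_3)$ (with $t_1,t_2,t_3$ arbitrary trees, possibly $|$). Its unique minimal element is $c_n$ and its unique maximal element is $d_n$. *)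

(* Defs.v *)
From HB Require Import structures.
From mathcomp Require Import all_boot all_order all_algebra.
From mathcomp Require Import boolp zify ring.

Set Implicit Arguments.
Unset Strict Implicit.
Unset Printing Implicit Defensive.

Import Order.TTheory GRing.Theory.
Local Open Scope ring_scope.

(* [Node s t] is the grafting of [s] (left) and [t] (right) on a new root. *)
Inductive tree := Leaf | Node of tree & tree.

Fixpoint tree_code (t : tree) : GenTree.tree unit :=
  if t is Node l r then GenTree.Node 0 [:: tree_code l; tree_code r]
  else GenTree.Leaf tt.

Fixpoint tree_decode (g : GenTree.tree unit) : option tree :=
  match g with
  | GenTree.Leaf _ => Some Leaf
  | GenTree.Node _ [:: l; r] =>
      if tree_decode l is Some l' then
        if tree_decode r is Some r' then Some (Node l' r') else None
      else None
  | _ => None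
  end.

Lemma tree_codeK : pcancel tree_code tree_decode.
Proof. by elim=> //= l -> r ->. Qed.

HB.instance Definition _ := Countable.copy tree (pcan_type tree_codeK).

Fixpoint order (t : tree) : nat :=
  if t is Node l r then (order l + order r).+1 else 0.

Definition vertex : tree := Node Leaf Leaf.

(* [over s t] is s/t: the root of [s] is grafted on the left-most leaf of [t]. *)
Fixpoint over (s t : tree) : tree :=
  if t is Node l r then Node (over s l) r else s.

(* [under s t] is s\t: the root of [t] is grafted on the right-most leaf of [s]. *)
Fixpoint under (s t : tree) : tree :=
  if s is Node l r then Node l (under r t) else t.

(* Since [over Leaf vertex = under vertex Leaf = vertex], starting from [Leaf]
   at index 0 gives c_1 = d_1 = vertex; only the indices n >= 1 are combs. *)
Fixpoint lcomb (n : nat) : tree :=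
  if n is m.+1 then over (lcomb m) vertex else Leaf.

Fixpoint rcomb (n : nat) : tree :=
  if n is m.+1 then under vertex (rcomb m) else Leaf.

Lemma order_eq0 t : (order t == 0%N) = (t == Leaf).
Proof. by case: t. Qed.

Lemma order_le1 t : (0 < order t <= 1)%N = (t == vertex).
Proof.
apply/idP/eqP => [|-> //].
by case: t => // -[|? ?] [|? ?] //=; rewrite ?addnS ltnS ?addSn ltn0.
Qed.

Lemma order_over s t : order (over s t) = (order s + order t)%N.
Proof. by elim: t => //= [|l -> r _]; rewrite ?addn0 // addnS addnA. Qed.

Lemma order_under s t : order (under s t) = (order s + order t)%N.
Proof. by elim: s => //= l _ r ->; rewrite addSn addnA. Qed.

Lemma order_lcomb n : order (lcomb n) = n.
Proof. by elim: n => //= n ->; rewrite addn0. Qed.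

Lemma order_rcomb n : order (rcomb n) = n.
Proof. by elim: n => //= n ->. Qed.

Lemma overA : associative over.
Proof. by move=> a b; elim=> //= l -> r _. Qed.

Lemma underA : associative under.
Proof. by move=> a b c; elim: a => //= l _ r ->. Qed.

Lemma over_under a b c : b != Leaf -> under (over a b) c = over a (under b c).
Proof. by case: b. Qed.

Record Yn (n : nat) := MkYn { Yn_tree :> tree; Yn_order : order Yn_tree == n }.

HB.instance Definition _ n := [isSub for @Yn_tree n].
HB.instance Definition _ n := [Countable of Yn n by <:].

(* A finite list containing (among others) all the trees of order at most h. *)
Fixpoint trees_height (h : nat) : seq tree :=
  if h is h'.+1 then
    Leaf :: [seq Node l r | l <- trees_height h', r <- trees_height h']
  else [:: Leaf].

Lemma mem_trees_height t h : (order t <= h)%N -> t \in trees_height h.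
Proof.
elim: t h => [|l IHl r IHr] [|h] //=; rewrite ltnS => le_h.
rewrite inE /=; apply/allpairsP; exists (l, r); split=> //=.
  by apply/IHl/(leq_trans _ le_h)/leq_addr.
by apply/IHr/(leq_trans _ le_h)/leq_addl.
Qed.

Definition Yn_enum n : seq (Yn n) := undup (pmap insub (trees_height n)).

Lemma Yn_enumP n : Finite.axiom (Yn_enum n).
Proof.
apply: Finite.uniq_enumP; first exact: undup_uniq.
move=> t; rewrite mem_undup mem_pmap_sub mem_trees_height //.
by rewrite (eqP (Yn_order t)).
Qed.

HB.instance Definition _ n := isFinite.Build (Yn n) (@Yn_enumP n).

Fact lcombY_subproof n : order (lcomb n) == n.
Proof. by rewrite order_lcomb. Qed.
Definition lcombY n : Yn n := MkYn (lcombY_subproof n).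

Fact vunderY_subproof n (t : Yn n) : order (under vertex t) == n.+1.
Proof. by rewrite order_under (eqP (Yn_order t)). Qed.
Definition vunderY n (t : Yn n) : Yn n.+1 := MkYn (vunderY_subproof t).

(* [rotation t t'] : t' is obtained from t by replacing one subtree of the form
   (t1 v t2) v t3 by t1 v (t2 v t3), at the root or inside a branch. *)
Fixpoint rotation (t t' : tree) : bool :=
  match t, t' with
  | Node a b, Node a' b' =>
      [|| (if a is Node a1 a2 then (a' == a1) && (b' == Node a2 b) else false),
          rotation a a' && (b == b')
        | (a == a') && rotation b b']
  | _, _ => false
  end.

Definition tamari n : rel (Yn n) := connect (fun t t' : Yn n => rotation t t').

(* A statistic that strictly increases along rotations. *)
Fixpoint right_weight (t : tree) : nat :=
  if t is Node l r then (right_weight l + right_weight r + order r)%N else 0.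

Lemma rotation_order t t' : rotation t t' -> order t = order t'.
Proof.
elim: t t' => [|l IHl r IHr] [|l' r'] //=; case/or3P.
- case: l {IHl} => // l1 l2 /andP[/eqP -> /eqP ->] /=.
  by rewrite addSn addnS addnA.
- by case/andP=> /IHl -> /eqP ->.
- by case/andP=> /eqP -> /IHr ->.
Qed.

Lemma rotation_weight t t' : rotation t t' -> (right_weight t < right_weight t')%N.
Proof.
elim: t t' => [|l IHl r IHr] [|l' r'] //=; case/or3P.
- case: l {IHl} => // l1 l2 /andP[/eqP -> /eqP ->] /=.
  by lia.
- by case/andP=> /IHl lt_l /eqP ->; rewrite !ltn_add2r.
- case/andP=> /eqP -> rot_r; rewrite -(rotation_order rot_r) ltn_add2r.
  by rewrite ltn_add2l IHr.
Qed.

Lemma tamari_weight n (t t' : Yn n) :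
  tamari t t' -> t = t' \/ (right_weight t < right_weight t')%N.
Proof.
case/connectP=> p; elim: p t => [|s p IHp] t /=; first by move=> _ ->; left.
case/andP=> /rotation_weight lt_ts /IHp{}IHp /IHp[<-|]; right=> //.
exact: ltn_trans lt_ts _.
Qed.

Fact tamari_refl n : reflexive (@tamari n).
Proof. exact: connect0. Qed.

Fact tamari_anti n : antisymmetric (@tamari n).
Proof.
move=> s t /andP[/tamari_weight[//|lt_st] /tamari_weight[//|lt_ts]].
by move: (ltn_trans lt_st lt_ts); rewrite ltnn.
Qed.

Fact tamari_trans n : transitive (@tamari n).
Proof. exact: connect_trans. Qed.

Fact tamari_display : Order.disp_t. Proof. exact: Order.Disp tt tt. Qed.

HB.instance Definition _ n := Order.Le_isPOrder.Build tamari_display (Yn n)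
  (@tamari_refl n) (@tamari_anti n) (@tamari_trans n).

Section Mobius.
Context {d : Order.disp_t} {T : finPOrderType d}.
Implicit Types x y z : T.

(* Recursion on the interval [x, y], with fuel [k]; #|T| units of fuel are
   enough, as shown by [mobiusE] below. *)
Fixpoint mobius_rec (k : nat) x y : int :=
  if k is k'.+1 then
    if x == y then 1
    else if (x < y)%O then - \sum_(z : T | (x <= z < y)%O) mobius_rec k' x z
    else 0
  else 0.

Definition mobius x y : int := mobius_rec #|T| x y.

Lemma mobius_rec_fuel k k' x y :
  (#|[pred z | (x <= z <= y)%O]| <= k)%N ->
  (#|[pred z | (x <= z <= y)%O]| <= k')%N -> mobius_rec k x y = mobius_rec k' x y.
Proof.
elim: k k' y => [|k IHk] [|k'] y //=; rewrite ?leqn0.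
- rewrite [_ == 0%N]eq_sym => /eqP/esym/eqP/pred0P/= I0 _.
  case: eqP => [eq_xy|_]; first by have := I0 y; rewrite /= eq_xy lexx.
  case: ifP => // lt_xy; have := I0 y; rewrite /= lexx ltW //.
- move=> _ /pred0P/= I0.
  case: eqP => [eq_xy|_]; first by have := I0 y; rewrite /= eq_xy lexx.
  case: ifP => // lt_xy; have := I0 y; rewrite /= lexx ltW //.
move=> le_k le_k'; case: eqP => // _; case: ifP => // lt_xy; congr (- _).
apply: eq_bigr => z /andP[le_xz lt_zy].
have lt_card : (#|[pred w | (x <= w <= z)%O]| < #|[pred w | (x <= w <= y)%O]|)%N.
  apply/proper_card/properP; split.
    apply/subsetP=> w; rewrite !inE => /andP[-> le_wz].
    exact: le_trans le_wz (ltW lt_zy).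
  exists y; rewrite !inE ?lexx ?(ltW lt_xy) //=.
  by rewrite lt_geF.
by apply: IHk; rewrite -ltnS; [apply: leq_trans le_k|apply: leq_trans le_k'].
Qed.

Lemma mobiusE x y :
  mobius x y = if x == y then 1
               else if (x < y)%O then - \sum_(z : T | (x <= z < y)%O) mobius x z
               else 0.
Proof.
rewrite /mobius (@mobius_rec_fuel _ #|T|.+1) ?max_card //.
exact: leq_trans (max_card _) _.
Qed.

End Mobius.

Section Series.
Context {R : comPzRingType}.

(* A series is given by its coefficients; the coefficient of the tree [Leaf]
   of order 0 is required to vanish in the group [Gdif] below. *)
Definition series := tree -> R.
Implicit Types (A B C : series) (S T U : series) (s t u : tree).

Definition mono t : series := fun u => (t == u)%:R.

(* The formal sum of the [F n] for n >= 1. It is meaningful when [F n] only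
   involves trees of order at least n, so that the coefficient of [u] in [F n]
   vanishes for n > order u. *)
Definition fsum (F : nat -> series) : series :=
  fun u => \sum_(1 <= n < (order u).+1) F n u.

(* Bilinear extension to series of an operation on trees of order at least 1
   that adds the orders, namely [over] and [under]. *)
Definition series_op (op : tree -> tree -> tree) A B : series :=
  fsum (fun n u => \sum_(s : Yn n)
    fsum (fun m v => \sum_(t : Yn m) A s * B t * mono (op s t) v) u).

Definition sover := series_op over.
Definition sunder := series_op under.

(* [spow T t] is T^t; the factors indexed by [Leaf] are omitted, so its value at
   [Leaf] is never used. *)
Fixpoint spow T (t : tree) : series :=
  match t with
  | Leaf => mono Leaf
  | Node Leaf Leaf => T
  | Node l Leaf => sover (spow T l) T
  | Node Leaf r => sunder T (spow T r)
  | Node l r => sunder (sover (spow T l) T) (spow T r)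
  end.

Definition scomp S T : series :=
  fsum (fun n u => \sum_(t : Yn n) S t * spow T t u).

(* Proof device: a list of the trees of order between 1 and N, to replace all
   the sums above by sums over a common finite range. *)
Definition trees N : seq tree :=
  [seq t <- undup (trees_height N) | (0 < order t <= N)%N].

Lemma trees_uniq N : uniq (trees N).
Proof. by rewrite filter_uniq ?undup_uniq. Qed.

Lemma mem_trees N t : (t \in trees N) = (0 < order t <= N)%N.
Proof.
rewrite mem_filter mem_undup andb_idr // => /andP[_].
exact: mem_trees_height.
Qed.

Lemma sum_trees N (f : tree -> R) :
  \sum_(1 <= n < N.+1) \sum_(t : Yn n) f t = \sum_(t <- trees N) f t.
Proof.
have e n : (1 <= n < N.+1)%N ->
    \sum_(t : Yn n) f t = \sum_(t <- trees N | order t == n) f t.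
  case/andP=> n1 nN.
  rewrite -[RHS]big_filter -[LHS](big_map (@Yn_tree n) xpredT f).
  apply: perm_big; apply: uniq_perm.
  - by rewrite map_inj_uniq ?index_enum_uniq //; apply: val_inj.
  - by rewrite filter_uniq ?trees_uniq.
  move=> t; rewrite mem_filter mem_trees; apply/mapP/idP.
    by case=> s _ ->; rewrite Yn_order (eqP (Yn_order s)) n1.
  by case/andP=> tn _; exists (MkYn tn); rewrite ?mem_index_enum.
rewrite big_nat (eq_bigr _ e) -big_nat.
rewrite (exchange_big_dep xpredT) //= big_seq [RHS]big_seq.
apply: eq_bigr => t; rewrite mem_trees => /andP[t0 tN].
under eq_bigl do rewrite eq_sym.
by rewrite big_nat1_eq ltnS t0 tN.
Qed.

Lemma sum_trees_widen N (u : tree) (f : tree -> R) : (order u <= N)%N ->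
  (forall t, (order u < order t)%N -> f t = 0) ->
  \sum_(t <- trees (order u)) f t = \sum_(t <- trees N) f t.
Proof.
move=> le_uN f0; rewrite [RHS](bigID (fun t => order t <= order u)%N) /=.
rewrite [X in _ + X]big1 ?addr0 => [|t]; last by rewrite -ltnNge => /f0.
rewrite -[RHS]big_filter; apply: perm_big; apply: uniq_perm.
- exact: trees_uniq.
- by rewrite filter_uniq ?trees_uniq.
by move=> t; rewrite [in RHS]mem_filter !mem_trees; lia.
Qed.

Lemma fsum_trees N (G : tree -> series) u : (order u <= N)%N ->
  (forall t, (order u < order t)%N -> G t u = 0) ->
  fsum (fun n v => \sum_(t : Yn n) G t v) u = \sum_(t <- trees N) G t u.
Proof.
move=> le_uN G0; rewrite /fsum (sum_trees _ (fun t => G t u)).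
exact: sum_trees_widen.
Qed.

Lemma sum_mono N t (f : tree -> R) :
  (0 < order t)%N -> ((N < order t)%N -> f t = 0) ->
  \sum_(w <- trees N) mono t w * f w = f t.
Proof.
move=> t0 ft0; have [tN|ntN] := boolP (t \in trees N).
  rewrite (big_rem t) //= /mono eqxx mul1r big1_seq ?addr0 // => w /=.
  rewrite mem_rem_uniq ?trees_uniq // inE eq_sym => /andP[/negbTE -> _].
  by rewrite mul0r.
rewrite ft0; last by move: ntN; rewrite mem_trees; lia.
rewrite big1_seq // => w /= wN; rewrite /mono.
by case: eqP wN ntN => [<- ->|_ _ _] //; rewrite mul0r.
Qed.

Lemma mono_gt t u : (order u < order t)%N -> mono t u = 0.
Proof. by rewrite /mono; case: eqP => // ->; rewrite ltnn. Qed.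

Definition additive_op op := forall s t, order (op s t) = (order s + order t)%N.

Lemma series_opE N op A B u : additive_op op -> (order u <= N)%N ->
  series_op op A B u =
    \sum_(s <- trees N) \sum_(t <- trees N) A s * B t * mono (op s t) u.
Proof.
move=> opD le_uN; pose G s t : series := fun v => A s * B t * mono (op s t) v.
have G0 s t : (order u < order s + order t)%N -> G s t u = 0.
  by move=> lt_u; rewrite /G mono_gt ?mulr0 ?opD.
rewrite /series_op.
rewrite (@fsum_trees N (fun s => fsum (fun m v => \sum_(t : Yn m) G s t v))) //.
  apply: eq_bigr => s _; rewrite (@fsum_trees N (G s)) // => t lt_u.
  by apply: G0; lia.
move=> s lt_u; rewrite (@fsum_trees N (G s)) // => [|t ?].
  by rewrite big1 // => t _; apply: G0; lia.
by apply: G0; lia.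
Qed.

Lemma sum_series_op N op A B (f : tree -> R) : additive_op op ->
  (forall t, (N < order t)%N -> f t = 0) ->
  \sum_(w <- trees N) series_op op A B w * f w =
    \sum_(s <- trees N) \sum_(t <- trees N) A s * B t * f (op s t).
Proof.
move=> opD f0.
have e w : w \in trees N -> series_op op A B w * f w =
    \sum_(s <- trees N) \sum_(t <- trees N) A s * B t * (mono (op s t) w * f w).
  rewrite mem_trees => /andP[_ le_w]; rewrite (series_opE _ _ opD le_w) mulr_suml.
  apply: eq_bigr => s _; rewrite mulr_suml.
  by apply: eq_bigr => t _; rewrite mulrA.
rewrite (eq_big_seq _ e) exchange_big /=; apply: eq_big_seq => s.
rewrite mem_trees => /andP[s0 _]; rewrite exchange_big /=; apply: eq_bigr => t _.
by rewrite -mulr_sumr sum_mono //; [rewrite opD; lia|apply: f0].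
Qed.

Lemma series_opA op1 op2 op3 op4 A B C :
    additive_op op1 -> additive_op op2 -> additive_op op3 -> additive_op op4 ->
    (forall a b c, b != Leaf -> op1 (op2 a b) c = op3 a (op4 b c)) ->
  series_op op1 (series_op op2 A B) C = series_op op3 A (series_op op4 B C).
Proof.
move=> D1 D2 D3 D4 e; apply: funext => u; set N := order u.
rewrite !(@series_opE N) //.
pose f w := \sum_(c <- trees N) C c * mono (op1 w c) u.
transitivity (\sum_(w <- trees N) series_op op2 A B w * f w).
  apply: eq_bigr => w _; rewrite mulr_sumr.
  by apply: eq_bigr => c _; rewrite mulrA.
rewrite sum_series_op //; last first.
  move=> w lt_w; rewrite /f big1 // => c _.
  by rewrite mono_gt ?mulr0 // D1; rewrite /N in lt_w; lia.
apply: eq_bigr => a _.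
transitivity (A a * \sum_(w <- trees N) series_op op4 B C w * mono (op3 a w) u);
  last by rewrite mulr_sumr; apply: eq_bigr => w _; rewrite mulrA.
rewrite sum_series_op // => [|w lt_w]; last first.
  by rewrite mono_gt // D3; rewrite /N in lt_w; lia.
rewrite mulr_sumr; apply: eq_big_seq => b; rewrite mem_trees => /andP[b0 _].
rewrite !mulr_sumr; apply: eq_bigr => c _.
by rewrite e -?order_eq0 -?lt0n // !mulrA.
Qed.

Lemma additive_over : additive_op over. Proof. exact: order_over. Qed.
Lemma additive_under : additive_op under. Proof. exact: order_under. Qed.
Hint Resolve additive_over additive_under : core.

Lemma soverA A B C : sover A (sover B C) = sover (sover A B) C.
Proof. by rewrite /sover; apply/esym/series_opA => // a b c _; rewrite overA. Qed.

Lemma sunderA A B C : sunder A (sunder B C) = sunder (sunder A B) C.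
Proof. by rewrite /sunder; apply/esym/series_opA => // a b c _; rewrite underA. Qed.

Lemma sover_under A B C : sunder (sover A B) C = sover A (sunder B C).
Proof. by apply: series_opA => // a b c; apply: over_under. Qed.

Lemma spow_Node T l r : spow T (Node l r) =
  let m := if l is Leaf then T else sover (spow T l) T in
  if r is Leaf then m else sunder m (spow T r).
Proof. by case: l; case: r. Qed.

Lemma spow_over T s t : s != Leaf -> t != Leaf ->
  spow T (over s t) = sover (spow T s) (spow T t).
Proof.
move=> sN; have sE (X Z : series) : (if s is Leaf then X else Z) = Z.
  by case: (s) sN.
elim: t => // l IHl r _ _; rewrite [over _ _]/= !spow_Node.
case: (eqVneq l Leaf) => [->|lN] /=.
  by rewrite sE; case: r => // r1 r2; rewrite sover_under.
have -> : (if over s l is Leaf then T else sover (spow T (over s l)) T) =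
          sover (sover (spow T s) (spow T l)) T.
  by rewrite IHl //; case: (l) lN.
case: l lN {IHl} => // l1 l2 _; case: r => [|r1 r2]; rewrite -soverA //.
by rewrite sover_under.
Qed.

Lemma spow_under T s t : s != Leaf -> t != Leaf ->
  spow T (under s t) = sunder (spow T s) (spow T t).
Proof.
move=> + tN; have tE (X Z : series) : (if t is Leaf then X else Z) = Z.
  by case: (t) tN.
elim: s => // l _ r IHr _; rewrite [under _ _]/= !spow_Node /=.
set m := match l with Leaf => T | _ => _ end.
have [-> | rN] := eqVneq r Leaf; first by rewrite /= tE.
have -> : (if under r t is Leaf then m else sunder m (spow T (under r t))) =
          sunder m (sunder (spow T r) (spow T t)).
  by rewrite IHr //; case: (r) rN.
by case: r rN {IHr} => // r1 r2 _; rewrite sunderA.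
Qed.

Lemma series_op_gt op A B p q u : additive_op op ->
  (forall s, (order s < p)%N -> A s = 0) -> (forall s, (order s < q)%N -> B s = 0) ->
  (order u < p + q)%N -> series_op op A B u = 0.
Proof.
move=> opD A0 B0 lt_u; rewrite (@series_opE (order u)) //.
rewrite big1 // => s _; rewrite big1 // => t _.
have [/A0 ->|le_ps] := ltnP (order s) p; first by rewrite !mul0r.
have [/B0 ->|le_qt] := ltnP (order t) q; first by rewrite mulr0 mul0r.
by rewrite mono_gt ?mulr0 // opD; lia.
Qed.

Lemma series_op_congr op A A' B B' p q k u : additive_op op ->
  (forall s, (order s < p)%N -> A s = 0) -> (forall s, (order s < p)%N -> A' s = 0) ->
  (forall s, (order s < q)%N -> B s = 0) -> (forall s, (order s < q)%N -> B' s = 0) ->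
  (forall s, (order s <= k + p)%N -> A s = A' s) ->
  (forall s, (order s <= k + q)%N -> B s = B' s) ->
  (order u <= k + p + q)%N -> series_op op A B u = series_op op A' B' u.
Proof.
move=> opD A0 A'0 B0 B'0 eA eB le_u; rewrite !(@series_opE (order u)) //.
apply: eq_bigr => s _; apply: eq_bigr => t _.
have [lt_s|le_ps] := ltnP (order s) p; first by rewrite A0 // A'0 // !mul0r.
have [lt_t|le_qt] := ltnP (order t) q; first by rewrite B0 // B'0 // !mulr0 !mul0r.
have [lt_u|le_opu] := ltnP (order u) (order s + order t).
  by rewrite !mono_gt ?mulr0 // opD.
by rewrite eA ?eB //; lia.
Qed.

Lemma spow_gt T t u : T Leaf = 0 -> (order u < order t)%N -> spow T t u = 0.
Proof.
move=> T0; elim: t u => // l IHl r IHr u; rewrite spow_Node /=.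
have T1 s : (order s < 1)%N -> T s = 0.
  by rewrite ltnS leqn0 order_eq0 => /eqP ->.
set m := match l with Leaf => T | _ => _ end.
have m0 s : (order s < (order l).+1)%N -> m s = 0.
  rewrite /m; case: l IHl {m} => [|l1 l2] IHl; first exact: T1.
  by move=> lt_s; apply: series_op_gt (IHl) T1 _ => //; rewrite addn1.
case: r IHr => [|r1 r2] IHr lt_u; first by apply: m0; rewrite /= addn0 in lt_u.
by apply: series_op_gt m0 (IHr) _ => //; rewrite addSn.
Qed.

Lemma spow_congr T T' k t u : T Leaf = 0 -> T' Leaf = 0 ->
  (forall s, (order s <= k.+1)%N -> T s = T' s) -> t != Leaf ->
  (order u <= k + order t)%N -> spow T t u = spow T' t u.
Proof.
move=> T0 T'0 eT; elim: t u => // l IHl r IHr u _.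
have P v w := @spow_gt T v w T0; have P' v w := @spow_gt T' v w T'0.
have T1 s : (order s < 1)%N -> T s = 0.
  by rewrite ltnS leqn0 order_eq0 => /eqP ->.
have T'1 s : (order s < 1)%N -> T' s = 0.
  by rewrite ltnS leqn0 order_eq0 => /eqP ->.
have step s : (order s <= k + (order l).+1)%N ->
    spow T (Node l Leaf) s = spow T' (Node l Leaf) s.
  rewrite !spow_Node /=; case: l IHl => [|l1 l2] IHl le_s.
    by apply: eT; rewrite addn1 in le_s.
  apply: (@series_op_congr _ _ _ _ _ (order (Node l1 l2)) 1 k) => //.
  - by move=> v; apply: P.
  - by move=> v; apply: P'.
  - by move=> v; apply: IHl.
  - by move=> v; rewrite addn1; apply: eT.
  - by rewrite -addnA addn1.
case: r IHr => [|r1 r2] IHr le_u; first by apply: step; rewrite /= addn0 in le_u.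
have e S : spow S (Node l (Node r1 r2)) =
           sunder (spow S (Node l Leaf)) (spow S (Node r1 r2)).
  by rewrite !spow_Node.
rewrite !e.
apply: (@series_op_congr _ _ _ _ _ (order l).+1 (order (Node r1 r2)) k) => //.
- by move=> v lt_v; apply: P; rewrite /= addn0.
- by move=> v lt_v; apply: P'; rewrite /= addn0.
- by move=> v; apply: P.
- by move=> v; apply: P'.
- by move=> v; apply: IHr.
- by move: le_u => /=; lia.
Qed.

Lemma scompE N S T u : T Leaf = 0 -> (order u <= N)%N ->
  scomp S T u = \sum_(t <- trees N) S t * spow T t u.
Proof.
move=> T0 le_u; rewrite /scomp.
rewrite (@fsum_trees N (fun t v => S t * spow T t v)) // => t lt_u.
by rewrite spow_gt ?mulr0.
Qed.

Lemma scomp_Leaf S T : scomp S T Leaf = 0.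
Proof. by rewrite /scomp /fsum /= big_geq. Qed.

Lemma scomp_op op S S' U : additive_op op -> U Leaf = 0 ->
    (forall s t, s != Leaf -> t != Leaf ->
       spow U (op s t) = series_op op (spow U s) (spow U t)) ->
  scomp (series_op op S S') U = series_op op (scomp S U) (scomp S' U).
Proof.
move=> opD U0 opU; apply: funext => u; set N := order u.
rewrite (@scompE N) // sum_series_op // => [|w]; last exact: spow_gt.
transitivity (\sum_(s <- trees N) \sum_(t <- trees N) \sum_(x <- trees N)
  \sum_(y <- trees N) S s * S' t * (spow U s x * spow U t y * mono (op x y) u)).
  apply: eq_big_seq => s; rewrite mem_trees => /andP[s0 _].
  apply: eq_big_seq => t; rewrite mem_trees => /andP[t0 _].
  rewrite opU -?order_eq0 -?lt0n // (@series_opE N) // mulr_sumr.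
  by apply: eq_bigr => x _; rewrite mulr_sumr.
rewrite (@series_opE N) //.
under eq_bigr do rewrite exchange_big /=.
rewrite exchange_big /=; apply: eq_big_seq => x.
rewrite mem_trees => /andP[_ xN].
under eq_bigr do rewrite exchange_big /=.
rewrite exchange_big /=; apply: eq_big_seq => y.
rewrite mem_trees => /andP[_ yN].
rewrite !(@scompE N) // !mulr_suml; apply: eq_bigr => s _.
rewrite mulr_sumr mulr_suml; apply: eq_bigr => t _.
by ring.
Qed.

Lemma scomp_spow T U t : U Leaf = 0 -> t != Leaf ->
  scomp (spow T t) U = spow (scomp T U) t.
Proof.
move=> U0; elim: t => // l IHl r IHr _; rewrite !spow_Node /=.
have cO S S' : scomp (sover S S') U = sover (scomp S U) (scomp S' U).
  by apply: scomp_op => // s t; apply: spow_over.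
have cU S S' : scomp (sunder S S') U = sunder (scomp S U) (scomp S' U).
  by apply: scomp_op => // s t; apply: spow_under.
by case: l IHl => [|l1 l2] IHl; case: r IHr => [|r1 r2] IHr;
  rewrite ?cU ?cO ?IHl ?IHr.
Qed.

Lemma scompA S T U : T Leaf = 0 -> U Leaf = 0 ->
  scomp S (scomp T U) = scomp (scomp S T) U.
Proof.
move=> T0 U0; apply: funext => u; set N := order u.
rewrite (@scompE N S) ?scomp_Leaf // (@scompE N _ U) //.
transitivity (\sum_(s <- trees N) \sum_(t <- trees N)
    S s * (spow T s t * spow U t u)).
  apply: eq_big_seq => s; rewrite mem_trees => /andP[s0 _].
  rewrite -scomp_spow -?order_eq0 -?lt0n // (@scompE N) //.
  by rewrite mulr_sumr.
rewrite exchange_big /=; apply: eq_big_seq => t.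
rewrite mem_trees => /andP[_ tN]; rewrite (@scompE N) // mulr_suml.
by apply: eq_bigr => s _; rewrite mulrA.
Qed.

Lemma scomp1s T : T Leaf = 0 -> scomp (mono vertex) T = T.
Proof.
move=> T0; apply: funext => u; have [->|uN] := eqVneq u Leaf.
  by rewrite scomp_Leaf.
rewrite (@scompE (order u)) //.
rewrite (@sum_mono _ vertex (fun t => spow T t u)) //=.
by move: uN; rewrite -order_eq0; case: (order u).
Qed.

Lemma series_op_mono op s t : additive_op op -> s != Leaf -> t != Leaf ->
  series_op op (mono s) (mono t) = mono (op s t).
Proof.
move=> opD; rewrite -!order_eq0 -!lt0n => s0 t0; apply: funext => u.
rewrite (@series_opE (order u)) //.
transitivity (\sum_(x <- trees (order u)) mono s x *
   \sum_(y <- trees (order u)) mono t y * mono (op x y) u).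
  by apply: eq_bigr => x _; rewrite mulr_sumr; apply: eq_bigr => y _; rewrite mulrA.
rewrite sum_mono // => [|lt_s].
  by rewrite sum_mono // => lt_t; apply: mono_gt; rewrite opD; lia.
rewrite big1 // => y _; rewrite [X in _ * X]mono_gt ?mulr0 // opD; lia.
Qed.

Lemma spow_vertex t : spow (mono vertex) t = mono t.
Proof.
elim: t => // l IHl r IHr; rewrite spow_Node /=.
set m := match l with Leaf => mono vertex | _ => _ end.
have -> : m = mono (Node l Leaf).
  rewrite /m; case: l IHl {m} => // l1 l2 ->.
  by rewrite /sover series_op_mono.
case: r IHr => // r1 r2 ->.
by rewrite /sunder series_op_mono.
Qed.

Lemma scomps1 S : S Leaf = 0 -> scomp S (mono vertex) = S.
Proof.
move=> S0; apply: funext => u; have [->|uN] := eqVneq u Leaf.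
  by rewrite scomp_Leaf.
rewrite (@scompE (order u)) //.
under eq_bigr => t _ do rewrite spow_vertex mulrC /mono eq_sym.
rewrite (@sum_mono _ u) ?ltnn //.
by rewrite lt0n order_eq0.
Qed.

(* The coefficients of the right inverse T of S, computed from S o T = vertex by
   recursion on the order: the term S_t T^t with t != vertex only involves the
   coefficients of T of smaller order. *)
Definition sinv_step S T : series := fun u =>
  mono vertex u - \sum_(t <- trees (order u) | t != vertex) S t * spow T t u.

Definition sinv S : series :=
  fun u => iter (order u) (sinv_step S) (fun=> 0) u.

Lemma sinv_step_Leaf S T : sinv_step S T Leaf = 0.
Proof. by rewrite /sinv_step big_seq_cond big_pred0 ?subr0 // => t; rewrite mem_trees; lia. Qed.

Lemma sinv_step_congr S T T' k u : T Leaf = 0 -> T' Leaf = 0 ->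
  (forall s, (order s <= k)%N -> T s = T' s) -> (order u <= k.+1)%N ->
  sinv_step S T u = sinv_step S T' u.
Proof.
move=> T0 T'0 eT le_u; rewrite /sinv_step; congr (_ - _).
rewrite big_seq_cond [RHS]big_seq_cond; apply: eq_bigr => t.
rewrite mem_trees => /andP[/andP[t0 le_t] tV]; congr (_ * _).
have t2 : (1 < order t)%N.
  by case: t tV t0 {le_t} => // -[|? ?] [|? ?] //= _ _; lia.
case: k eT le_u => [|k] eT le_u; first by lia.
by apply: (@spow_congr _ _ k) => //; [rewrite -order_eq0 -lt0n|lia].
Qed.

Definition sinv_iter S k : series := iter k (sinv_step S) (fun=> 0).

Lemma sinv_iter_Leaf S k : sinv_iter S k Leaf = 0.
Proof. by case: k => //= k; apply: sinv_step_Leaf. Qed.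

Lemma sinv_iterS S k u : (order u <= k)%N -> sinv_iter S k.+1 u = sinv_iter S k u.
Proof.
elim: k u => [|k IHk] u le_u.
  move: le_u; rewrite leqn0 order_eq0 => /eqP ->.
  by rewrite !sinv_iter_Leaf.
apply: (@sinv_step_congr _ (sinv_iter S k.+1) (sinv_iter S k) k) => //.
  exact: sinv_iter_Leaf.
exact: sinv_iter_Leaf.
Qed.

Lemma sinv_iterE S k u : (order u <= k)%N -> sinv_iter S k u = sinv S u.
Proof.
elim: k => [|k IHk] le_u; first by rewrite /sinv; case: (order u) le_u.
move: le_u; rewrite leq_eqVlt => /predU1P[<-|lt_u] //.
by rewrite sinv_iterS // IHk.
Qed.

Lemma sinv_Leaf S : sinv S Leaf = 0.
Proof. by []. Qed.

Lemma sinvE S : sinv S = sinv_step S (sinv S).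
Proof.
apply: funext => u; rewrite -[LHS](@sinv_iterE _ (order u).+1) //.
apply: (@sinv_step_congr _ _ _ (order u)) => //; first exact: sinv_iter_Leaf.
exact: sinv_iterE.
Qed.

Lemma scomp_vertex S T : T Leaf = 0 -> scomp S T vertex = S vertex * T vertex.
Proof.
move=> T0; rewrite (@scompE 1) // (bigD1_seq vertex) ?mem_trees ?trees_uniq //=.
rewrite big_seq_cond big1 ?addr0 // => t.
by rewrite mem_trees order_le1 => /andP[/eqP ->]; rewrite eqxx.
Qed.

Lemma sinv_vertex S : sinv S vertex = 1.
Proof.
rewrite sinvE /sinv_step [mono _ _]/mono eqxx big_seq_cond big1 ?subr0 // => t.
by rewrite mem_trees order_le1 => /andP[/eqP ->]; rewrite eqxx.
Qed.

Lemma scomp_sinv S : S vertex = 1 -> scomp S (sinv S) = mono vertex.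
Proof.
move=> S1; apply: funext => u; have [->|uN] := eqVneq u Leaf.
  by rewrite scomp_Leaf.
rewrite (@scompE (order u)) // (bigD1_seq vertex) ?trees_uniq //=; last first.
  by rewrite mem_trees /= lt0n order_eq0.
by rewrite S1 mul1r {1}sinvE /sinv_step subrK.
Qed.

End Series.

Arguments series : clear implicits.
Arguments mono {R} t u.

Record Gdif (R : comPzRingType) := MkGdif {
  Gdif_series :> tree -> R;
  Gdif_Leaf : Gdif_series Leaf = 0;
  Gdif_vertex : Gdif_series vertex = 1 }.

Section Gdif.
Context {R : comPzRingType}.
Implicit Types S T U : Gdif R.

Lemma Gdif_inj S T : Gdif_series S = Gdif_series T -> S = T.
Proof.
case: S T => [S S0 S1] [T T0 T1] /= eST; case: T / eST T0 T1 => T0 T1.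
by congr MkGdif; apply: Prop_irrelevance.
Qed.

Fact mono_vertex_vertex : mono vertex vertex = 1 :> R.
Proof. by rewrite /mono eqxx. Qed.

Definition Gdif_one : Gdif R := @MkGdif R (mono vertex) erefl mono_vertex_vertex.

Fact Gdif_mul_subproof S T : scomp S T vertex = 1.
Proof. by rewrite scomp_vertex ?Gdif_Leaf // !Gdif_vertex mulr1. Qed.

Definition Gdif_mul S T : Gdif R := MkGdif (scomp_Leaf S T) (Gdif_mul_subproof S T).

Definition Gdif_inv S : Gdif R := MkGdif (sinv_Leaf S) (sinv_vertex S).

Fact Gdif_mulA : associative Gdif_mul.
Proof. by move=> S T U; apply/Gdif_inj/scompA; apply: Gdif_Leaf. Qed.

Fact Gdif_mul1g : left_id Gdif_one Gdif_mul.
Proof. by move=> S; apply/Gdif_inj/scomp1s/Gdif_Leaf. Qed.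

Fact Gdif_mulg1 : right_id Gdif_one Gdif_mul.
Proof. by move=> S; apply/Gdif_inj/scomps1/Gdif_Leaf. Qed.

Fact Gdif_mulgV : right_inverse Gdif_one Gdif_inv Gdif_mul.
Proof. by move=> S; apply/Gdif_inj/scomp_sinv/Gdif_vertex. Qed.

Fact Gdif_mulVg : left_inverse Gdif_one Gdif_inv Gdif_mul.
Proof.
move=> S; rewrite -[in RHS](Gdif_mulgV (Gdif_inv S)); congr (Gdif_mul _ _).
rewrite -[LHS]Gdif_mulg1 -[in LHS](Gdif_mulgV (Gdif_inv S)).
by rewrite Gdif_mulA Gdif_mulgV Gdif_mul1g.
Qed.

HB.instance Definition _ := gen_eqMixin (Gdif R).
HB.instance Definition _ := gen_choiceMixin (Gdif R).
(* The group law [S * T] is the composition S o T. *)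
HB.instance Definition _ := isGroup.Build (Gdif R)
  Gdif_mulA Gdif_mul1g Gdif_mulg1 Gdif_mulVg Gdif_mulgV.

Definition lcombs_series : series R := fsum (fun n => mono (lcomb n)).
Definition rcombs_series : series R := fsum (fun n => mono (rcomb n)).

Fact lcombs_Leaf : lcombs_series Leaf = 0.
Proof. by rewrite /lcombs_series /fsum big_geq. Qed.

Fact lcombs_vertex : lcombs_series vertex = 1.
Proof. by rewrite /lcombs_series /fsum big_nat1 /mono eqxx. Qed.

Fact rcombs_Leaf : rcombs_series Leaf = 0.
Proof. by rewrite /rcombs_series /fsum big_geq. Qed.

Fact rcombs_vertex : rcombs_series vertex = 1.
Proof. by rewrite /rcombs_series /fsum big_nat1 /mono eqxx. Qed.

End Gdif.

(* The series C and D. *)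
Definition lcombs (R : comPzRingType) : Gdif R := MkGdif lcombs_Leaf lcombs_vertex.
Definition rcombs (R : comPzRingType) : Gdif R := MkGdif rcombs_Leaf rcombs_vertex.

(* Main.v *)
From HB Require Import structures.
From mathcomp Require Import all_boot all_order all_algebra.
From mathcomp Require Import boolp zify.
Require Import Defs.

Set Implicit Arguments.
Unset Strict Implicit.
Unset Printing Implicit Defensive.

Import Order.TTheory GRing.Theory.
Local Open Scope ring_scope.

(** Both sides are computed in closed form and compared.

    On the side of series, C = Y + C/Y and D = Y + D\Y. Composing with
    T = D^-1 on the right, which is a morphism for the over and under products,
    turns these equations into E = T + E/T and Y = T + Y\T. The second one says
    that T is supported on the right combs, with coefficient (-1)^(n-1) on d_n
    ([rcombs_invE]); the first one then says that E is supported on the trees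
    d_(n_1)/.../d_(n_k), with coefficient the product of the (-1)^(n_i - 1)
    ([lcombs_rcombs_invE]). This coefficient is [comb_sign].

    On the side of the Tamari lattice, mu(c_n, -) is characterised by the
    vanishing of its sum over every interval [c_n, t] with t != c_n, so the point
    is that [comb_sign] has this property ([sum_comb_sign]). A tree
    d_(n_1)/.../d_(n_k) amounts to a subset of {1, ..., n - 1}, namely the i such
    that the vertices i and i + 1 (in infix order) lie in the same right comb.
    Such a tree is below t in the Tamari order if and only if its subset is
    contained in the set A(t) of the i such that the vertex i + 1 of t has no left
    child. The sum is therefore the alternating sum over the subsets of A(t),
    which is zero unless A(t) is empty, that is, unless t is the left comb.

    The set A(t) is encoded by the boolean word [canopy t], and the comb trees
    below t are enumerated by [combs_below (canopy t)]. A rotation can only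
    enlarge A(t) ([canopy_rotation]), which gives one implication of the
    characterisation; [combs_below_canopy_cat] gives the other one.

    Finally, the root of Y\t has t on its right and nothing on its left, so
    mu(c_(n+1), Y\t) is [rcomb_sign t], that is (-1)^n if t is the right comb and
    0 otherwise. These are the coefficients found for T. *)

(** * Trees and the Tamari order *)

Lemma Node_eq l r l' r' : (Node l r == Node l' r') = (l == l') && (r == r').
Proof. by apply/eqP/andP=> [[-> ->]|[/eqP -> /eqP ->]]. Qed.

Lemma rcombSr n : rcomb n.+1 = under (rcomb n) vertex.
Proof. by elim: n => //= n <-. Qed.

Lemma under_vertex_inj : injective (under^~ vertex).
Proof.
elim=> [|l _ r IHr] [|l' r'] //=; first by case: r'.
  by case: r {IHr}.
by case=> -> /IHr ->.
Qed.

(** The Tamari order without the indexing by the number of vertices, so that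
    trees of different orders can be combined; see [leYnE]. *)
Inductive tamari_le : tree -> tree -> Prop :=
| tamari_le_refl t : tamari_le t t
| tamari_le_step s t u : rotation s t -> tamari_le t u -> tamari_le s u.
#[local] Hint Constructors tamari_le : core.

Lemma tamari_le_trans s t u : tamari_le s t -> tamari_le t u -> tamari_le s u.
Proof. by elim=> // {}s t' v st _ IH /IH; apply: tamari_le_step. Qed.

Lemma tamari_le_homo (f : tree -> tree) s t :
  (forall s t, rotation s t -> rotation (f s) (f t)) ->
  tamari_le s t -> tamari_le (f s) (f t).
Proof. by move=> fR; elim=> // {}s u v /fR su _; apply: tamari_le_step. Qed.

Lemma tamari_le_Nodel r s t : tamari_le s t -> tamari_le (Node s r) (Node t r).
Proof.
apply: (tamari_le_homo (f := Node^~ r)) => {}s {}t st.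
by rewrite /= st eqxx orbT.
Qed.

Lemma tamari_le_Noder l s t : tamari_le s t -> tamari_le (Node l s) (Node l t).
Proof. by apply: tamari_le_homo => {}s {}t st; rewrite /= st eqxx !orbT. Qed.

(** The vertex carrying [l] and [r] slides down the right branch of [s], by one
    rotation at each vertex of this branch. *)
Lemma Node_under_le s l r : tamari_le (Node (under s l) r) (under s (Node l r)).
Proof.
elim: s => //= a _ b IHb.
apply: (@tamari_le_step _ (Node a (Node (under b l) r))); last exact: tamari_le_Noder.
by rewrite /= !eqxx.
Qed.

Lemma leYnE n (s t : Yn n) : (s <= t)%O <-> tamari_le s t.
Proof.
split=> [/connectP[p]|].
  elim: p s => [|u p IHp] s /=; first by move=> _ ->.
  by case/andP=> su /IHp{}IHp /IHp; apply: tamari_le_step.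
move def_x: (s : tree) => x; move def_y: (t : tree) => y xy.
elim: xy s def_x def_y => {x y} [x|x y z xy _ IH] s sx tz.
  by rewrite (_ : s = t) //; apply: val_inj; rewrite /= sx tz.
have yn : order y == n by rewrite -(rotation_order xy) -sx Yn_order.
apply: le_trans (IH (MkYn yn) erefl tz).
by apply: connect1; rewrite sx.
Qed.

(** * Comb trees below a given tree *)

(** One bit for each vertex, the vertices being read from right to left: is its
    left subtree empty? The last bit, that of the left-most vertex, is always
    [true] ([canopy_last]); the others tell the orientation of the inner leaves,
    whence the name. *)
Fixpoint canopy (t : tree) : seq bool :=
  if t is Node l r then canopy r ++ (l == Leaf) :: canopy l else [::].

Lemma size_canopy t : size (canopy t) = order t.
Proof. by elim: t => //= l IHl r IHr; rewrite size_cat /= IHl IHr addnS addnC. Qed.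

Lemma canopy_under_vertex s : canopy (under s vertex) = true :: canopy s.
Proof. by elim: s => //= l _ r ->. Qed.

Lemma canopy_last t : t != Leaf -> exists b, canopy t = rcons b true.
Proof.
elim: t => // l IHl r _ _ /=; have [->|/IHl[b ->]] := eqVneq l Leaf.
  by exists (canopy r); rewrite cats1.
by exists (canopy r ++ false :: b); rewrite rcons_cat.
Qed.

Lemma all2_implb_refl b : all2 implb b b.
Proof. by elim: b => //= x b ->; rewrite implybb. Qed.

(** The rotation of (t1 v t2) v t3 into t1 v (t2 v t3) only affects the bit of the
    root of the former, whose left subtree t1 v t2 becomes t2. *)
Lemma canopy_rotation s t : rotation s t -> all2 implb (canopy s) (canopy t).
Proof.
elim: s t => // a IHa b IHb [|a' b'] //= st.
have catP c1 c2 c1' c2' : size c1 = size c1' ->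
    all2 implb c1 c1' -> all2 implb c2 c2' -> all2 implb (c1 ++ c2) (c1' ++ c2').
  move=> + + h2; elim: c1 c1' => [|x c1 IH] [|x' c1'] //= [/IH{}IH].
  by case/andP=> -> /IH.
case/or3P: st.
- case: a {IHa} => // a1 a2 /andP[/eqP -> /eqP ->] /=.
  by rewrite -catA; apply: catP => //=; rewrite all2_implb_refl.
- case/andP=> aa' /eqP <-; apply: catP; rewrite ?all2_implb_refl //=.
  rewrite (IHa _ aa') andbT.
  by case: (a) aa'.
- case/andP=> /eqP <- bb'; apply: catP; rewrite ?IHb ?all2_implb_refl //.
  by rewrite !size_canopy (rotation_order bb').
Qed.

(** Trees d_(n_1)/.../d_(n_k) built by adding the vertices from left to right: a
    new right-most vertex either starts a new right comb ([over s vertex]) or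
    extends the last one ([under s vertex]), the latter only when its bit is set.
    Both choices give the same tree when [s] is [Leaf], whence the condition on
    [b']. *)
Fixpoint combs_below (b : seq bool) : seq tree :=
  if b is x :: b' then
    [seq over s vertex | s <- combs_below b'] ++
    (if x && (b' != [::]) then [seq under s vertex | s <- combs_below b'] else [::])
  else [:: Leaf].

Lemma order_combs_below b s : s \in combs_below b -> order s = size b.
Proof.
elim: b s => [|x b IHb] s /=; first by rewrite inE => /eqP ->.
rewrite mem_cat => /orP[/mapP[s' /IHb <- ->]|]; first by rewrite /= addn0.
case: ifP => // _ /mapP[s' /IHb <- ->].
by rewrite order_under addn1.
Qed.

Lemma combs_below_uniq b : uniq (combs_below b).
Proof.
elim: b => //= x b IHb; rewrite cat_uniq map_inj_uniq ?IHb => [/=|s t [] //].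
case: ifP => // /andP[_ bN]; rewrite map_inj_uniq ?IHb; last exact: under_vertex_inj.
rewrite andbT; apply/hasPn=> _ /mapP[s /order_combs_below sb ->].
apply/mapP=> -[s' _]; case: s sb => [|l [|? ?]] //=.
by case: b bN {IHb}.
Qed.

Lemma lcomb_combs_below b : lcomb (size b) \in combs_below b.
Proof. by elim: b => //= x b IHb; rewrite mem_cat map_f. Qed.

Lemma combs_below_mono b b' : all2 implb b b' ->
  {subset combs_below b <= combs_below b'}.
Proof.
elim: b b' => [|x b IHb] [|x' b'] //= bb' s //; case/andP: bb' => xx' bb'.
rewrite !mem_cat => /orP[/mapP[s' s'b ->]|].
  by apply/orP; left; apply/mapP; exists s' => //; exact: IHb.
case: ifP => // /andP[xT bN] /mapP[s' s'b ->].
have -> : x' by move: xx'; rewrite xT.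
have -> : b' != [::] by case: (b) (b') bN bb' => [|? ?] [].
by apply/orP; right; apply/mapP; exists s' => //; exact: IHb.
Qed.

(** Strengthens [combs_below_le] to prefixes of a word, since the induction on [t]
    splits the canopy of a tree into those of its two subtrees. *)
Lemma combs_below_canopy_cat t b s : s \in combs_below (canopy t ++ b) ->
  exists2 s', s' \in combs_below b & tamari_le s (under s' t).
Proof.
elim: t b s => [|l IHl r IHr] b s /=.
  by move=> sb; exists s => //; elim: (s) => //= u _ v; apply: tamari_le_Noder.
rewrite -catA cat_cons => /IHr[s2 /=]; rewrite mem_cat => /orP[].
  case/mapP=> s3 /IHl[s4 s4b le3] -> le_s; exists s4 => //.
  apply: tamari_le_trans le_s _; apply: tamari_le_trans (Node_under_le s4 l r).
  exact: tamari_le_Nodel.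
case: ifP => // /andP[/eqP -> _] /mapP[s3 s3b -> le_s].
by exists s3 => //; move: le_s; rewrite -underA.
Qed.

Lemma combs_below_le t s : s \in combs_below (canopy t) -> tamari_le s t.
Proof.
by rewrite -[canopy t]cats0 => /combs_below_canopy_cat[s']; rewrite inE => /eqP ->.
Qed.

(** * The sign of a comb tree *)

(** (-1)^n on the right comb with n vertices, and 0 on the other trees. *)
Fixpoint rcomb_sign (t : tree) : int :=
  match t with
  | Leaf => 1
  | Node Leaf r => - rcomb_sign r
  | _ => 0
  end.

(** The product of the (-1)^(n_i - 1) on d_(n_1)/.../d_(n_k), and 0 on the other
    trees: if the root carries [rcomb m] on the right, then it starts a right comb
    with m + 1 vertices, which contributes (-1)^m. *)
Fixpoint comb_sign (t : tree) : int :=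
  if t is Node l r then comb_sign l * rcomb_sign r else 1.

Lemma rcomb_sign_neq0 t : rcomb_sign t != 0 -> t = rcomb (order t).
Proof. by elim: t => // -[|? ?] // _ r IHr; rewrite /= oppr_eq0 => /IHr {1}->. Qed.

Lemma comb_sign_under s : s != Leaf -> comb_sign (under s vertex) = - comb_sign s.
Proof.
case: s => //= l r _; rewrite -mulrN; congr (_ * _).
by elim: r => // -[|? ?] _ r IHr //=; rewrite IHr.
Qed.

Lemma comb_sign_lcomb n : comb_sign (lcomb n) = 1.
Proof. by elim: n => //= n ->. Qed.

(** With [combs_below_homo] and [combs_below_le], this identifies the trees of
    nonzero sign below [t] with the entries of [combs_below (canopy t)]. *)
Lemma mem_combs_below_canopy s : comb_sign s != 0 -> s \in combs_below (canopy s).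
Proof.
elim: s => // l IHl r _; rewrite [comb_sign _]/= mulf_eq0 negb_or.
case/andP=> /IHl{}IHl /rcomb_sign_neq0 ->; elim: (order r) => [|n IHn].
  by rewrite /= mem_cat; apply/orP; left; apply/mapP; exists l.
rewrite rcombSr -[Node l _]/(under (Node l (rcomb n)) vertex) canopy_under_vertex.
have := size_canopy (Node l (rcomb n)); rewrite [order _]/=.
move: (Node l (rcomb n)) IHn => s /=.
case: (canopy s) => // x b sb _; rewrite mem_cat; apply/orP; right.
by apply/mapP; exists s.
Qed.

Lemma combs_below_homo s t x : tamari_le s t ->
  x \in combs_below (canopy s) -> x \in combs_below (canopy t).
Proof.
elim=> // {}s u v su _ IH xs; apply/IH.
exact: combs_below_mono (canopy_rotation su) _ xs.
Qed.

(** The bit [true] gives the choice between [over s vertex] and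
    [under s vertex], whose signs are opposite when [s] is not [Leaf]. *)
Lemma sum_combs_below_cat b b' : b' != [::] ->
  \sum_(s <- combs_below (b ++ true :: b')) comb_sign s = 0.
Proof.
move=> b'N; elim: b => [|x b IHb] /=.
  rewrite b'N big_cat !big_map /= -big_split big1_seq //= => s sb.
  rewrite comb_sign_under ?mulr1 ?addrN // -order_eq0 (order_combs_below sb).
  by case: (b') b'N.
rewrite big_cat !big_map /=; under eq_bigr do rewrite mulr1.
rewrite IHb add0r; case: ifP => _; last by rewrite big_nil.
rewrite big_map (eq_big_seq (fun s => - comb_sign s)) ?sumrN ?IHb ?oppr0 // => s sb.
rewrite comb_sign_under // -order_eq0 (order_combs_below sb) size_cat /=.
by rewrite addnS.
Qed.

(** If some right subtree on the left branch of [t] is not empty, then the last bit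
    of the canopy of this subtree is an inner [true], which makes the sum vanish. *)
Lemma sum_combs_below_canopy t : t != lcomb (order t) ->
  \sum_(s <- combs_below (canopy t)) comb_sign s = 0.
Proof.
elim: t => // l IHl r _.
have [->|/canopy_last[b] /= ->] := eqVneq r Leaf; last first.
  by rewrite cat_rcons sum_combs_below_cat.
rewrite [order _]/= addn0 => /= tN.
(* The bit of the root is set only if [l] is [Leaf], and then no vertex precedes
   the root: either way there is no choice for this vertex. *)
rewrite (_ : _ && _ = false) ?cats0 ?big_map /=; last first.
  by case: l {IHl tN} => //= ? r1; case: canopy.
under eq_bigr do rewrite mulr1.
by apply: IHl; apply: contraNneq tN => {1}->.
Qed.

Lemma sum_comb_sign n (t : Yn n) : t != lcombY n ->
  \sum_(s : Yn n | (s <= t)%O) comb_sign s = 0.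
Proof.
move=> tN; have tn : order t = n by apply/eqP/Yn_order.
rewrite -[RHS](@sum_combs_below_canopy t); last first.
  by rewrite tn; apply: contra_neq tN => tc; apply: val_inj.
transitivity (\sum_(s : Yn n | val s \in combs_below (canopy t)) comb_sign s).
  (* A tree of sign 0 contributes nothing on either side. *)
  rewrite big_mkcond [RHS]big_mkcond; apply: eq_bigr => s _ /=.
  have [s0|sN] := eqVneq (comb_sign s) 0; first by rewrite s0 !if_same.
  congr (if _ then _ else _); apply/idP/idP => [/leYnE st|/combs_below_le/leYnE //].
  exact: combs_below_homo st (mem_combs_below_canopy sN).
rewrite -big_filter -(big_map val xpredT comb_sign); apply: perm_big.
apply: uniq_perm; rewrite ?combs_below_uniq //.
  by rewrite map_inj_uniq ?filter_uniq ?index_enum_uniq //; apply: val_inj.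
move=> s; apply/mapP/idP => [[s' + ->]|sb]; first by rewrite mem_filter => /andP[].
have sn : order s == n by rewrite (order_combs_below sb) size_canopy tn.
by exists (MkYn sn) => //; rewrite mem_filter sb mem_index_enum.
Qed.

Lemma lcombY_le n (t : Yn n) : (lcombY n <= t)%O.
Proof.
apply/leYnE/combs_below_le; have := lcomb_combs_below (canopy t).
by rewrite size_canopy (eqP (Yn_order t)).
Qed.

(** The recursion defining the Möbius function says that its sums over the
    intervals [c, t] vanish for t != c, and determines it. *)
Lemma mobius_unique (d : Order.disp_t) (T : finPOrderType d) (c : T) (f : T -> int) :
    (forall t, (c <= t)%O) -> f c = 1 ->
    (forall t, t != c -> \sum_(s | (s <= t)%O) f s = 0) ->
  mobius c =1 f.
Proof.
move=> cmin fc fsum0 t.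
have [k] := ubnP #|[pred s | (s <= t)%O]|; elim: k t => // k IHk t; rewrite ltnS => le_k.
rewrite mobiusE eq_sym; case: eqVneq => [->|tN]; first by rewrite fc.
rewrite lt_neqAle cmin eq_sym tN /=; apply/esym/eqP; rewrite -addr_eq0; apply/eqP.
rewrite -[RHS](fsum0 t tN) [RHS](bigD1 t) //=; congr (_ + _).
apply: eq_big => [s|s /andP[_ st]]; first by rewrite cmin lt_neqAle /= andbC.
apply: IHk; apply: leq_trans le_k; apply/proper_card/properP; split.
  by apply/subsetP=> u; rewrite !inE => /le_trans/(_ (ltW st)).
by exists t; rewrite !inE ?lexx ?lt_geF.
Qed.

Lemma mobius_lcombY n (t : Yn n) : mobius (lcombY n) t = comb_sign t.
Proof.
apply: (mobius_unique (f := fun t : Yn n => comb_sign t)).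
- exact: lcombY_le.
- exact: comb_sign_lcomb.
- exact: sum_comb_sign.
Qed.

(** * Coefficients of the series *)

Section Series.
Context {R : comPzRingType}.
Implicit Types A B S T : series R.

Lemma series_eq A B : A Leaf = B Leaf ->
  (forall l r, A (Node l r) = B (Node l r)) -> A = B.
Proof. by move=> eL eN; apply: funext => -[|l r]. Qed.

Lemma series_op_Leaf op A B : series_op op A B Leaf = 0.
Proof. by rewrite /series_op /fsum big_geq. Qed.

Lemma series_op_none op A B u : additive_op op ->
    (forall s t, s != Leaf -> t != Leaf -> op s t = u -> A s * B t = 0) ->
  series_op op A B u = 0.
Proof.
move=> opD AB0; rewrite (@series_opE _ (order u)) //.
rewrite big1_seq // => s /=; rewrite mem_trees lt0n order_eq0 => /andP[sN _].
rewrite big1_seq // => t /=; rewrite mem_trees lt0n order_eq0 => /andP[tN _].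
rewrite /mono; case: eqP => [/AB0 ->|_]; rewrite ?mul0r ?mulr0 //.
Qed.

Lemma series_op_single op A B s0 t0 : additive_op op -> s0 != Leaf -> t0 != Leaf ->
    (forall s t, s != Leaf -> t != Leaf -> op s t = op s0 t0 ->
       (s, t) != (s0, t0) -> A s * B t = 0) ->
  series_op op A B (op s0 t0) = A s0 * B t0.
Proof.
move=> opD s0N t0N AB0; set u := op s0 t0; set N := order u.
rewrite (@series_opE _ N) //.
transitivity (\sum_(s <- trees N) mono s0 s *
    (\sum_(t <- trees N) mono t0 t * (A s * B t))); last first.
  rewrite !sum_mono ?lt0n ?order_eq0 // /N /u opD; lia.
apply: eq_big_seq => s; rewrite mem_trees lt0n order_eq0 => /andP[sN _].
rewrite mulr_sumr.
apply: eq_big_seq => t; rewrite mem_trees lt0n order_eq0 => /andP[tN _].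
have [[-> ->]|st] := eqVneq (s, t) (s0, t0).
  by rewrite /mono !eqxx !mul1r mulr1.
rewrite [RHS]mulrA.
have -> : mono s0 s * mono t0 t = 0 :> R.
  move: (st); rewrite /mono xpair_eqE negb_and ![_ == s0]eq_sym ![_ == t0]eq_sym.
  by case/orP=> /negbTE ->; rewrite ?mul0r ?mulr0.
rewrite mul0r /mono; case: eqP => [est|_]; last by rewrite mulr0.
by rewrite AB0 ?mul0r.
Qed.

Lemma sover_Node A B l r : B Leaf = 0 ->
    (forall t t', t != Leaf -> B (Node t t') = 0) ->
  sover A B (Node l r) = if l == Leaf then 0 else A l * B (Node Leaf r).
Proof.
move=> B0 BN; have D := additive_over; have [->|lN] := eqVneq l Leaf.
  apply: series_op_none => // s [|t t'] //= sN _.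
  by have [->|tN _] := eqVneq t Leaf; [case: (s) sN|rewrite BN ?mulr0].
rewrite -[Node l r]/(over l (Node Leaf r)); apply: series_op_single => //.
move=> s [|t t'] // _ _; have [->|tN _ _] := eqVneq t Leaf; last by rewrite BN ?mulr0.
by case=> -> ->; rewrite eqxx.
Qed.

Lemma sunder_vertex_Node A l r :
  sunder (mono vertex) A (Node l r) = if (l == Leaf) && (r != Leaf) then A r else 0.
Proof.
have D := additive_under; case: ifP => [/andP[/eqP -> rN]|lr].
  rewrite -[Node Leaf r]/(under vertex r) /sunder series_op_single //.
    by rewrite /mono eqxx mul1r.
  move=> s t _ _; rewrite [in mono _ _]/mono.
  case: (vertex =P s) => [<-|_ _ _]; last by rewrite mul0r.
  by case=> ->; rewrite eqxx.
apply: series_op_none => // s t _ tN; rewrite [mono _ _]/mono.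
case: (vertex =P s) => [<- [el er]|_ _]; last by rewrite mul0r.
by move: lr; rewrite -el -er eqxx tN.
Qed.

Lemma fsum_mono (F : nat -> tree) u : (forall n, order (F n) = n) ->
  fsum (fun n => mono (F n)) u = ((u != Leaf) && (u == F (order u)))%:R :> R.
Proof.
move=> oF; rewrite -order_eq0 -lt0n /fsum.
case: posnP => [->|u_gt0]; first by rewrite big_geq.
rewrite big_nat_recr //= big_nat big1 ?add0r => [|n /andP[_ lt_n]].
  by rewrite /mono eq_sym.
by rewrite /mono; case: eqP => // eu; rewrite -eu oF ltnn in lt_n.
Qed.

Lemma lcombs_rec :
  lcombs_series = mono vertex \+ sover lcombs_series (mono vertex) :> series R.
Proof.
apply: series_eq => [|l r].
  by rewrite lcombs_Leaf /= [sover _ _ _]series_op_Leaf addr0.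
rewrite /= sover_Node => [|//|t t' tN]; last first.
  by rewrite /mono Node_eq eq_sym (negbTE tN).
rewrite /lcombs_series !fsum_mono; [|exact: order_lcomb..].
rewrite /mono !(eq_sym vertex) /= !Node_eq eqxx.
have [->|lN] := eqVneq l Leaf; have [->|rN] := eqVneq r Leaf.
- by rewrite addr0.
- by rewrite andbF addr0.
- by rewrite addn0 add0r mulr1 andbT.
- by rewrite andbF mulr0 addr0.
Qed.

(** The new vertex is added at the right end of the comb, rather than at the root,
    for the inverse of D to appear as the right factor in [rcombs_inv_rec]: the
    product Y\T has a single term on each tree, unlike T\Y. *)
Lemma rcombs_rec :
  rcombs_series = mono vertex \+ sunder rcombs_series (mono vertex) :> series R.
Proof.
have D := additive_under; apply: funext => u.
have rcE v : rcombs_series v = ((v != Leaf) && (v == rcomb (order v)))%:R :> R.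
  by rewrite /rcombs_series fsum_mono //; apply: order_rcomb.
have [/andP[uN /eqP ur]|uNr] := boolP ((u != Leaf) && (u == rcomb (order u))).
  rewrite rcE uN -ur eqxx /= ur; case: (order u) ur => [|[|n]] ur.
  - by rewrite ur in uN.
  - rewrite /= /mono [vertex == _]eqxx [sunder _ _ _]series_op_none ?addr0 // => s t.
    rewrite -!order_eq0 -!lt0n => s0 t0 /(congr1 order); rewrite D /=; lia.
  rewrite [rcomb _.+2]rcombSr /sunder series_op_single //.
    rewrite rcE order_rcomb eqxx [mono _ (under _ _)]/mono.
    have /negbTE-> : vertex != under (rcomb n.+1) vertex.
      by apply/eqP=> /(congr1 order); rewrite D order_rcomb addn1.
    by rewrite /mono eqxx mulr1 add0r.
  move=> s t _ _; rewrite [in mono _ _]/mono.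
  case: (vertex =P t) => [<-|_ _ _]; last by rewrite mulr0.
  by move/under_vertex_inj=> ->; rewrite eqxx.
rewrite rcE (negbTE uNr) /= [sunder _ _ _]series_op_none ?addr0.
- by rewrite /mono; case: (vertex =P u) uNr => // <-; rewrite eqxx.
- exact: D.
move=> s t _ _ ust; rewrite rcE [mono _ _]/mono.
case: (vertex =P t) ust => [<- us|_ _]; last by rewrite mulr0.
case: (s =P rcomb (order s)) => [sr|_]; last by rewrite andbF mul0r.
case/negP: uNr; rewrite -us -order_eq0 D addn1 /= -[vertex]/(rcomb 1).
by rewrite [X in under X _]sr -rcombSr.
Qed.

Lemma scompD A B T : T Leaf = 0 -> scomp (A \+ B) T = scomp A T \+ scomp B T.
Proof.
move=> T0; apply: funext => u; rewrite /= !(@scompE _ (order u)) // -big_split.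
by apply: eq_bigr => t _; rewrite mulrDl.
Qed.

(** The equation D = Y + D\Y composed with T = D^-1, using D o T = Y. *)
Lemma rcombs_inv_rec (T := ((rcombs R)^-1)%g : series R) u :
  mono vertex u = T u + sunder (mono vertex) T u.
Proof.
have T0 : T Leaf = 0 by apply: Gdif_Leaf.
have DT : scomp rcombs_series T = mono vertex.
  by have /(congr1 (@Gdif_series R)) := mulgV (rcombs R).
rewrite -[in LHS]DT rcombs_rec scompD // scomp1s //.
rewrite /sunder (@scomp_op _ under) ?DT ?scomp1s //; first exact: additive_under.
by move=> s t; apply: spow_under.
Qed.

Lemma rcombs_invE u :
  ((rcombs R)^-1)%g u = if u == Leaf then 0 else - (rcomb_sign u)%:~R.
Proof.
elim: u => [|l _ r IHr]; first exact: Gdif_Leaf.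
have := rcombs_inv_rec (Node l r).
rewrite sunder_vertex_Node /mono Node_eq !(eq_sym Leaf).
case: l => [|? ?] /=; last by rewrite addr0 oppr0 => <-.
move: IHr; case: r => [|r1 r2] /= IHr.
  by rewrite addr0 => <-; rewrite mulrNz opprK.
by rewrite IHr => /esym/eqP; rewrite addr_eq0 mulrNz => /eqP ->.
Qed.

(** The equation C = Y + C/Y composed with T = D^-1. *)
Lemma lcombs_rcombs_inv_rec (T := ((rcombs R)^-1)%g : series R)
    (E := (lcombs R * (rcombs R)^-1)%g : series R) u :
  E u = T u + sover E T u.
Proof.
have T0 : T Leaf = 0 by apply: Gdif_Leaf.
have EE : E = scomp lcombs_series T by [].
rewrite [in LHS]EE lcombs_rec scompD // scomp1s // EE.
rewrite /sover (@scomp_op _ over) ?scomp1s //; first exact: additive_over.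
by move=> s t; apply: spow_over.
Qed.

(** As T is supported on trees with empty left subtree, E/T has at most one term on
    l v r, coming from l/(Y\r). *)
Lemma lcombs_rcombs_invE u : (lcombs R * (rcombs R)^-1)%g u =
  if u == Leaf then 0 else (comb_sign u)%:~R :> R.
Proof.
elim: u => [|l IHl r _]; first exact: Gdif_Leaf.
rewrite lcombs_rcombs_inv_rec sover_Node => [||t t' tN]; last 2 first.
- exact: Gdif_Leaf.
- by rewrite rcombs_invE; case: t tN => //= *; rewrite oppr0.
rewrite IHl !rcombs_invE; case: l {IHl} => [|l1 l2].
  by rewrite addr0 [comb_sign _]/= mul1r mulrNz opprK.
by rewrite /= !intrM oppr0 add0r mulrNz opprK.
Qed.

Lemma fsum_coef_mono (f : tree -> R) u :
  fsum (fun n v => \sum_(t : Yn n) f t * mono t v) u = if u == Leaf then 0 else f u.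
Proof.
rewrite (@fsum_trees _ (order u) (fun t v => f t * mono t v)) //; last first.
  by move=> t lt_u; rewrite mono_gt ?mulr0.
rewrite -order_eq0; case: posnP => [->|u0]; first by rewrite big_nil.
rewrite -(@sum_mono _ (order u) u f) //; last by rewrite ltnn.
by apply: eq_bigr => t _; rewrite mulrC /mono eq_sym.
Qed.

Lemma fsum_coef_mono_under (f : tree -> R) u :
  fsum (fun n v => \sum_(t : Yn n) f t * mono (under vertex t) v) u =
    sunder (mono vertex) f u.
Proof.
rewrite (@fsum_trees _ (order u) (fun t v => f t * mono (under vertex t) v)) //.
  rewrite /sunder (@series_opE _ (order u)) //; last exact: additive_under.
  rewrite exchange_big; apply: eq_bigr => t _.
  under [RHS]eq_bigr do rewrite -mulrA.
  rewrite (@sum_mono _ _ vertex (fun s => f t * mono (under s t) u)) // => lt_u.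
  by rewrite mono_gt ?mulr0 // order_under (leq_trans lt_u) ?leq_addr.
by move=> t lt_u; rewrite mono_gt ?mulr0 // order_under (leq_trans lt_u) ?leq_addl.
Qed.

End Series.

Theorem proposition3p3 (R : comPzRingType) :
  let C : Gdif R := lcombs R in
  let D : Gdif R := rcombs R in
  let E : Gdif R := (C * D^-1)%g in
  E =1 fsum (fun n u =>
         \sum_(t : Yn n) (mobius (lcombY n) t)%:~R * mono t u)
  /\
  (D^-1)%g =1 (fun v => mono vertex v +
     fsum (fun n u =>
       \sum_(t : Yn n)
         (mobius (lcombY n.+1) (vunderY t))%:~R * mono (vunderY t) u) v).
Proof.
split=> u.
  rewrite lcombs_rcombs_invE -(fsum_coef_mono (fun t => (comb_sign t)%:~R)).
  by apply: eq_bigr => n _; apply: eq_bigr => t _; rewrite mobius_lcombY.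
transitivity (mono vertex u +
    sunder (mono vertex) (fun t => (rcomb_sign t)%:~R) u : R); last first.
  rewrite -fsum_coef_mono_under; congr (_ + _).
  by apply: eq_bigr => n _; apply: eq_bigr => t _; rewrite mobius_lcombY /= mul1r.
rewrite rcombs_invE; case: u => [|l r].
  by rewrite /mono add0r [sunder _ _ _]series_op_Leaf.
rewrite sunder_vertex_Node /mono Node_eq !(eq_sym Leaf).
by case: l => [|? ?]; case: r => [|? ?];
  rewrite /= ?(add0r, addr0, oppr0, mulrNz, opprK).
Qed.
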